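(* Let $p$ be an odd prime, and let $d$ be an integer with $\left(\frac{-d}{p}\right)=1$. Then $$S_{p-2}(d,p)\equiv\begin{cases}(-1)^{(p+3)/4}\,d^{(p-1)/4}\left(\left(\frac{p-3}{2}\right)!!\right)^2\pmod p & \text{if } p\equiv 1\pmod 4,\\ 0\pmod p & \text{if } p\equiv 3\pmod 4.\end{cases}$$
   Context: $\left(\frac{\cdot}{p}\right)$ denotes the Legendre symbol, and $k!!$ denotes the double factorial of $k$ (for odd $k\geqslant 1$, $k!!=1\cdot 3\cdot 5\cdots k$; note that $\frac{p-3}{2}$ is odd when $p\equiv 1\pmod 4$). For an odd prime $p$, an integer $d$ and a positive integer $m$, $S_m(d,p)$ denotes the integer $$S_m(d,p)=\det\left[(i^2+dj^2)^m\right]_{1\leqslant i,j\leqslant (p-1)/2}.$$ *)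

(* Defs.v *)
From mathcomp Require Import all_boot all_order all_algebra.

Set Implicit Arguments.
Unset Strict Implicit.
Unset Printing Implicit Defensive.

Import GRing.Theory.
Local Open Scope ring_scope.

Definition legendre (a : int) (p : nat) : int :=
  if (p%:Z %| a)%Z then 0
  else if [exists x : 'I_p, ((x%:Z ^+ 2 == a %[mod p%:Z])%Z)] then 1
  else - 1.

Fixpoint double_fact (n : nat) : nat :=
  match n with
  | k.+2 => (k.+2 * double_fact k)%N
  | _ => 1%N
  end.

(* Ordinals start at 0, so the row and column indices are shifted by one. *)
Definition S_mx (m : nat) (d : int) (p : nat) : 'M[int]_((p.-1)./2) :=
  \matrix_(i, j) ((i.+1%:Z ^+ 2 + d * j.+1%:Z ^+ 2) ^+ m).

Definition S_det (m : nat) (d : int) (p : nat) : int := \det (S_mx m d p).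

(* Main.v *)
Require Import Defs.
From mathcomp Require Import all_boot all_order all_algebra all_field.
From mathcomp Require Import zify ring.

Import GRing.Theory.
Local Open Scope ring_scope.

(** The idea is that modulo [p] the matrix factors through a Vandermonde-like
pair, so that its determinant is a product of coefficients.

Put [n = (p - 1) / 2].  In ['F_p] the squares [x i = i ^ 2], for
[1 <= i <= n], are exactly the [n] roots of ['X^n - 1], and
[p - 2 = 2 n - 1].  Expanding [(x i + d * x j) ^ (2 n - 1)] by the binomial
formula and reducing exponents by [x ^ n = 1] merges the terms of index [k]
and [n + k], whence
  [(x i + d * x j) ^ (2 n - 1) = \sum_(k < n) c k * x i ^ (n - 1 - k) * x j ^ k]
with [c k = 'C(2 n - 1, k) d ^ k + 'C(2 n - 1, n + k) d ^ (n + k)].  So the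
matrix is [U * diag c * V], where [U * V] collects the geometric sums
[\sum_k x i ^ (n - 1 - k) * x j ^ k].  These vanish off the diagonal because
[x i ^ n - x j ^ n = 0], so [U * V] is diagonal with entries
[n * x i ^ (n - 1)].  This yields, over any field
([det_power_of_linear_forms]), the determinant
[(-1) ^ (n - 1) * n ^ n * \prod_k c k].

In characteristic [p], ['C(p - 2, k) = (-1) ^ k * (k + 1)]
([bin_char_sub2]).  The hypothesis on [- d] means [(- d) ^ n = 1], and
[2 n = - 1]; hence [c k = (- d) ^ k * (2 k + 1 - n)].

If [p = 3 %[mod 4]] then [n] is odd and the factor with [2 k + 1 = n]
vanishes.  If [p = 1 %[mod 4]], write [n = 2 m]: the numbers [2 k + 1 - n] are
[-(n - 1), ..., -1, 1, ..., n - 1], the odd ones, with product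
[(-1) ^ m * (n - 1)!! ^ 2]; the powers of [- d] multiply to [(- d) ^ m]; and
[n ^ n = 2 ^ n = (-1) ^ m], the last equality being the value of the
Legendre symbol of 2, which is obtained here by Gauss's pairing argument
([two_expr_half]).  The signs combine to the announced one. *)

(** * The determinant over an arbitrary field *)

(** Evaluate ['X^n - 1 = \prod_i ('X - x i)] at 0. *)
Lemma prod_roots_of_unity (F : fieldType) (n : nat) (x : 'I_n -> F) :
    (0 < n)%N -> injective x -> (forall i, x i ^+ n = 1) ->
  \prod_i x i = (- 1) ^+ n.-1.
Proof.
move=> n_gt0 x_inj x_unity.
have Xn1 : 'X^n - 1%:P = \prod_(i < n) ('X - (x i)%:P).
  transitivity (\prod_(z <- map x (enum 'I_n)) ('X - z%:P)); last first.
    by rewrite big_map big_enum.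
  rewrite [LHS](@all_roots_prod_XsubC _ _ (map x (enum 'I_n))).
  - by rewrite (monicP (monicXnsubC 1 n_gt0)) scale1r.
  - by rewrite size_XnsubC // size_map size_enum_ord.
  - apply/allP=> _ /mapP[i _ ->].
    by rewrite rootE !hornerE x_unity subrr.
  - by rewrite uniq_rootsE map_inj_uniq // enum_uniq.
have := congr1 (horner^~ 0) Xn1.
rewrite horner_prod !hornerE expr0n gtn_eqF // sub0r.
under eq_bigr => i _ do rewrite !hornerE.
rewrite prodrN card_ord => eq_m1.
by rewrite -[LHS](signrMK n) -eq_m1 -[in LHS](prednK n_gt0) exprS; ring.
Qed.

(** A kernel that is a sum of [n] products of a function of [i] and a function
of [j] is a product of square matrices, so weights on the summands come out
of the determinant. *)
Lemma det_sum_separable (R : comPzRingType) (n : nat)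
    (u v : 'I_n -> 'I_n -> R) (c : 'I_n -> R) :
  \det (\matrix_(i, j) \sum_k c k * (u i k * v k j)) =
  \det (\matrix_(i, j) \sum_k u i k * v k j) * \prod_k c k.
Proof.
pose U : 'M[R]_n := \matrix_(i, k) u i k.
pose V : 'M[R]_n := \matrix_(k, j) v k j.
have -> : \matrix_(i, j) (\sum_k c k * (u i k * v k j)) =
          U *m diag_mx (\row_k c k) *m V.
  apply/matrixP=> i j; rewrite !mxE; apply: eq_bigr => k _.
  by rewrite mul_mx_diag !mxE; ring.
have -> : \matrix_(i, j) (\sum_k u i k * v k j) = U *m V.
  by apply/matrixP=> i j; rewrite !mxE; apply: eq_bigr => k _; rewrite !mxE.
rewrite !det_mulmx det_diag.
under [in LHS]eq_bigr => k _ do rewrite mxE.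
by ring.
Qed.

(** The matrix is diagonal: for [i != j] the sum is the quotient of
[x i ^+ n - x j ^+ n = 0] by [x i - x j]. *)
Lemma det_geometric_sums (F : fieldType) (n : nat) (x : 'I_n -> F) :
    (0 < n)%N -> injective x -> (forall i, x i ^+ n = 1) ->
  \det (\matrix_(i, j) \sum_(k < n) x i ^+ (n.-1 - k) * x j ^+ k) =
  (- 1) ^+ n.-1 * n%:R ^+ n.
Proof.
move=> n_gt0 x_inj x_unity.
have -> : \matrix_(i, j) (\sum_(k < n) x i ^+ (n.-1 - k) * x j ^+ k) =
          diag_mx (\row_i (n%:R * x i ^+ n.-1)).
  apply/matrixP=> i j; rewrite !mxE.
  have [<-|neq_ij] := eqVneq i j.
    rewrite mulr1n (eq_bigr (fun=> x i ^+ n.-1)).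
      by rewrite sumr_const card_ord mulr_natl.
    by move=> k _; rewrite -exprD subnK // -ltnS prednK.
  rewrite mulr0n; apply/eqP.
  have := subrXX (x i) (x j) n; rewrite !x_unity subrr => /esym/eqP.
  by rewrite mulf_eq0 subr_eq0 (inj_eq x_inj) (negPf neq_ij).
rewrite det_diag.
under eq_bigr => i _ do rewrite mxE.
rewrite big_split prodr_const card_ord /= mulrC prodrXl.
(* The exponent is a square, hence has the parity of [n.-1]. *)
rewrite prod_roots_of_unity // -exprM -[in RHS]signr_odd -[in LHS]signr_odd.
by rewrite oddM andbb.
Qed.

(** The exponent [2 n - 1] gives [2 n] binomial terms; as [x i ^+ n = 1], those
of index [k] and [n + k] involve the same monomial in [x i] and [x j]. *)
Lemma det_power_of_linear_forms (F : fieldType) (n : nat) (x : 'I_n -> F)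
    (d : F) :
    (0 < n)%N -> injective x -> (forall i, x i ^+ n = 1) ->
  \det (\matrix_(i, j) (x i + d * x j) ^+ (n + n).-1) =
  (- 1) ^+ n.-1 * n%:R ^+ n *
  \prod_(k < n) ('C((n + n).-1, k)%:R * d ^+ k
                 + 'C((n + n).-1, n + k)%:R * d ^+ (n + k)).
Proof.
move=> n_gt0 x_inj x_unity.
rewrite -(det_geometric_sums _ _ x) // -det_sum_separable.
congr (\det _); apply/matrixP=> i j.
rewrite !mxE exprDn prednK ?addn_gt0 ?n_gt0 //.
rewrite big_split_ord /= -big_split; apply: eq_bigr => k _ /=.
have kn := ltn_ord k.
have -> : ((n + n).-1 - k = n + (n.-1 - k))%N by lia.
have -> : ((n + n).-1 - (n + k) = n.-1 - k)%N by lia.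
rewrite !exprMn !(exprD (x _) n) !x_unity !mul1r.
rewrite -[X in X + _ = _]mulr_natl -[X in _ + X = _]mulr_natl; ring.
Qed.

(** * Binomial coefficients and products of integers *)

(** By induction: [(m + 1) * 'C(p - 2, m + 1) = (p - 2 - m) * 'C(p - 2, m)], and
[p - 2 - m] is [- (m + 2)] in characteristic [p]. *)
Lemma bin_char_sub2 (R : idomainType) (p m : nat) :
    p \in [char R] -> (m < p.-1)%N ->
  'C(p - 2, m)%:R = (- 1) ^+ m * m.+1%:R :> R.
Proof.
move=> charRp; elim: m => [|m IHm] lt_mp; first by rewrite bin0 mul1r.
have m1_neq0 : m.+1%:R != 0 :> R.
  by rewrite -(dvdn_pcharf charRp) gtnNdvd //; lia.
apply: (mulfI m1_neq0); rewrite -natrM mul_bin_left natrM IHm; last lia.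
have -> : (p - 2 - m)%:R = - m.+2%:R :> R.
  apply/eqP; rewrite -addr_eq0 -natrD -(dvdn_pcharf charRp).
  by have -> : (p - 2 - m + m.+2 = p)%N by lia.
by rewrite exprS; ring.
Qed.

Lemma prod_outside_in (R : comPzRingType) (m : nat) (f : nat -> R) :
  \prod_(i < m + m) f i = \prod_(k < m) (f k * f (m + m - k.+1)%N).
Proof.
rewrite big_split_ord big_split; congr (_ * _).
rewrite (reindex_inj rev_ord_inj); apply: eq_bigr => k _ /=.
by congr (f _); have := ltn_ord k; lia.
Qed.

Lemma double_fact_oddE (m : nat) :
  double_fact (m + m).-1 = (\prod_(k < m) (k + k).+1)%N.
Proof.
elim: m => [|m IHm]; first by rewrite big_ord0.
rewrite big_ord_recr -IHm /=.
by case: m {IHm} => //= m; rewrite !addnS /= mulnC.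
Qed.

(** The factors are the odd numbers from [- (2 m - 1)] to [2 m - 1], paired here
with their opposites. *)
Lemma prod_centered_odds (R : comPzRingType) (m : nat) :
  \prod_(k < m + m) ((k + k).+1%:R - (m + m)%:R) =
  (- 1) ^+ m * (double_fact (m + m).-1)%:R ^+ 2 :> R.
Proof.
rewrite (prod_outside_in _ _ (fun k => (k + k).+1%:R - (m + m)%:R)).
rewrite double_fact_oddE natr_prod -prodrXl.
rewrite -[X in (-1) ^+ X](card_ord m) -prodrN (reindex_inj rev_ord_inj) /=.
apply: eq_bigr => k _ /=; have kn := ltn_ord k.
have -> : (m - k.+1 + (m - k.+1)).+1%:R = (m + m)%:R - (k + k).+1%:R :> R.
  by rewrite -natrB; [congr _%:R | ]; lia.
have -> : (m + m - (m - k.+1).+1 = m + k)%N by lia.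
by rewrite -!natr1 !natrD; ring.
Qed.

(** Gauss's argument, with [p = 4 m + 1] zero in [F]: doubling the numbers from
1 to [2 m] gives the even numbers up to [4 m], and those above [2 m] are the
opposites of the odd numbers below [2 m].  So [2 ^ (2 m) * (2 m)!] and
[(-1) ^ m * (2 m)!] agree. *)
Lemma two_expr_half (F : fieldType) (m : nat) :
    (m + m + m + m).+1%:R = 0 :> F -> (m + m)`!%:R != 0 :> F ->
  2 ^+ (m + m) = (- 1) ^+ m :> F.
Proof.
move=> p0 fact_neq0; apply: (mulIf fact_neq0).
rewrite fact_prod big_add1 big_mkord natr_prod.
rewrite -[X in 2 ^+ X](card_ord (m + m)) -prodrMl /=.
rewrite (prod_outside_in _ _ (fun k => 2 * k.+1%:R)).
rewrite -[X in (-1) ^+ X](card_ord m).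
have -> : \prod_(i < m + m) i.+1%:R =
          \prod_(k < m) ((k + k).+1%:R * (k + k).+2%:R) :> F.
  elim: (m) => [|n IHn]; first by rewrite !big_ord0.
  by rewrite addSn addnS !big_ord_recr IHn /= mulrA.
rewrite -prodrMl; apply: eq_bigr => k _; have kn := ltn_ord k.
have -> : (m + m - k.+1).+1 = (m + m - k)%N by lia.
rewrite natrB; last lia.
move: p0; rewrite -!natr1 !natrD => p0.
(* The difference of the two sides is [2 * (k + 1) * (4 * m + 1)]. *)
apply: subr0_eq; rewrite -[RHS](mul0r (2 * (k%:R + 1))) -[X in _ = X * _]p0.
ring.
Qed.

(** The exponents add up to [m * (2 m - 1)], which is [m] modulo [2 m]. *)
Lemma prod_expr_half (R : comPzRingType) (e : R) (m : nat) :
  e ^+ (m + m) = 1 -> \prod_(k < m + m) e ^+ k = e ^+ m.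
Proof.
move=> e_unity; rewrite (prod_outside_in _ _ (fun k => e ^+ k)).
rewrite (eq_bigr (fun=> e ^+ (m + m).-1)); last first.
  by move=> k _; have := ltn_ord k; rewrite -exprD => ?; congr (_ ^+ _); lia.
rewrite prodr_const card_ord -exprM -[LHS]mulr1 -e_unity -exprD.
have -> : ((m + m).-1 * m + (m + m) = (m + m) * m + m)%N by nia.
by rewrite exprD exprM e_unity expr1n mul1r.
Qed.

(** * The squares modulo p *)

(** If [a ^+ 2 = b ^+ 2] then [a = b] or [a + b = 0], and the second is excluded
because [0 < a + b < p] when [a] and [b] lie between 1 and [(p - 1) / 2]. *)
Lemma sqr_half_inj (p : nat) :
  prime p -> injective (fun i : 'I_(p.-1./2) => i.+1%:R ^+ 2 : 'F_p).
Proof.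
move=> p_prime i j /eqP; rewrite eqf_sqr.
have i_lt := ltn_ord i; have j_lt := ltn_ord j.
have natr_inj a b : (a <= b < p)%N -> a%:R = b%:R :> 'F_p -> a = b.
  move=> ab /esym/eqP; rewrite -subr_eq0 -natrB; last lia.
  rewrite -(dvdn_pcharf (pchar_Fp p_prime)) => dvd.
  have : ~~ (0 < b - a)%N by apply: contraL dvd => ?; rewrite gtnNdvd //; lia.
  lia.
case/orP=> /eqP.
  move=> eq_ij; apply: val_inj => /=.
  case: (leqP i j) => ij; [|apply: esym]; apply: eq_add_S.
    by apply: natr_inj => //; lia.
  by apply: natr_inj => //; lia.
move/eqP; rewrite -addr_eq0 -natrD -(dvdn_pcharf (pchar_Fp p_prime)).
by rewrite gtnNdvd //; lia.
Qed.

Lemma sqr_half_unity (p : nat) (a : 'F_p) :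
  prime p -> odd p -> a != 0 -> (a ^+ 2) ^+ p.-1./2 = 1.
Proof.
move=> p_prime p_odd a_neq0; apply: (mulfI a_neq0).
rewrite -exprM -exprS mulr1 -[RHS](expf_card a) card_Fp //.
by congr (_ ^+ _); lia.
Qed.

(** * Reduction modulo p *)

Lemma det_norm_forms_Fp (p : nat) (d : 'F_p) (n := p.-1./2) :
    prime p -> odd p -> (- d) ^+ n = 1 ->
  \det (\matrix_(i < n, j < n) (i.+1%:R ^+ 2 + d * j.+1%:R ^+ 2) ^+ (p - 2)) =
  (- 1) ^+ n.-1 * n%:R ^+ n *
  \prod_(k < n) ((- d) ^+ k * ((k + k).+1%:R - n%:R)).
Proof.
move=> p_prime p_odd d_unity.
have p_gt1 := prime_gt1 p_prime.
have n_def : p = (n + n).+1 by rewrite /n; lia.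
have charFp := pchar_Fp p_prime.
have -> : (p - 2 = (n + n).-1)%N by lia.
rewrite (det_power_of_linear_forms _ _ (fun i => i.+1%:R ^+ 2)); first last.
- move=> i; apply: sqr_half_unity => //.
  have i_lt := ltn_ord i.
  by rewrite -(dvdn_pcharf charFp) gtnNdvd //; lia.
- exact: sqr_half_inj.
- lia.
congr (_ * _); apply: eq_bigr => k _; have k_lt := ltn_ord k.
have -> : ((n + n).-1 = p - 2)%N by lia.
rewrite !(bin_char_sub2 _ _ _ charFp); [|lia..].
have p0 : n%:R + n%:R + 1 = 0 :> 'F_p.
  by rewrite -natrD natr1 -n_def pchar_Fp_0.
rewrite mulrAC -exprNn [X in _ + X]mulrAC -exprNn exprD d_unity mul1r -mulrDr.
(* What remains, [k + 1 + (n + k + 1) = 2 k + 1 - n], is [2 n + 1 = 0]. *)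
congr (_ * _); apply: subr0_eq.
by rewrite -[RHS]p0 -!natr1 !natrD; ring.
Qed.

Lemma legendre1_unity (p : nat) (a : int) :
  prime p -> odd p -> legendre a p = 1 -> (a%:~R : 'F_p) ^+ p.-1./2 = 1.
Proof.
move=> p_prime p_odd; rewrite /legendre.
case: ifP => // /negbT pNa; case: ifP => // /existsP[x /eqP x2_eq] _.
have charFp := pchar_Fp p_prime.
have a_sqr : a%:~R = x%:R ^+ 2 :> 'F_p.
  apply/eqP; rewrite eq_sym -subr_eq0 -[x%:R]/(x%:Z%:~R) -rmorphXn -rmorphB /=.
  by rewrite -(dvdz_pcharf charFp) -eqz_mod_dvd x2_eq.
rewrite a_sqr; apply: sqr_half_unity => //; apply: contra pNa => x0.
by rewrite (dvdz_pcharf charFp) a_sqr expf_eq0 x0.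
Qed.

Lemma half_expr_half_Fp (p m : nat) :
    prime p -> p = (m + m + m + m).+1 ->
  (m + m)%:R ^+ (m + m) = (- 1) ^+ m :> 'F_p.
Proof.
move=> p_prime p_def.
have p0 : (m + m + m + m).+1%:R = 0 :> 'F_p by rewrite -p_def pchar_Fp_0.
have two_half : 2 ^+ (m + m) = (- 1) ^+ m :> 'F_p.
  apply: two_expr_half => //.
  rewrite fact_prod natr_prod big_add1 big_mkord; apply/prodf_neq0 => k _.
  rewrite -(dvdn_pcharf (pchar_Fp p_prime)) gtnNdvd //.
  by have := ltn_ord k; lia.
(* Multiply by [2 ^+ (m + m)] and use [2 * (m + m) = - 1]. *)
rewrite -[LHS](signrMK m) -two_half -exprMn.
have -> : 2 * (m + m)%:R = - 1 :> 'F_p.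
  by apply/eqP; rewrite -addr_eq0 -p0 -natr1 !natrD; apply/eqP; ring.
by rewrite -[in (-1) ^+ (m + m)]signr_odd oddD addbb mulr1.
Qed.

Theorem theorem1p3 (p : nat) (d : int)
    (p_prime : prime p) (p_odd : odd p)
    (Hd : legendre (- d) p = 1) :
  (p = 1 %[mod 4] ->
     (S_det (p - 2) d p
      = (- 1) ^+ ((p + 3) %/ 4)%N * d ^+ ((p - 1) %/ 4)%N
        * (double_fact ((p - 3) %/ 2))%:Z ^+ 2 %[mod p%:Z])%Z)
  /\ (p = 3 %[mod 4] -> (S_det (p - 2) d p = 0 %[mod p%:Z])%Z).
Proof.
have charFp := pchar_Fp p_prime.
have p_gt1 := prime_gt1 p_prime.
have modpP (a b : int) : a%:~R = b%:~R :> 'F_p -> (a = b %[mod p%:Z])%Z.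
  move=> eq_ab; apply/eqP.
  by rewrite eqz_mod_dvd (dvdz_pcharf charFp) rmorphB /= eq_ab subrr.
have := legendre1_unity _ _ p_prime p_odd Hd; rewrite rmorphN /= => d_unity.
have S_detE : (S_det (p - 2) d p)%:~R =
    \det (\matrix_(i < p.-1./2, j < p.-1./2)
      (i.+1%:R ^+ 2 + d%:~R * j.+1%:R ^+ 2) ^+ (p - 2)) :> 'F_p.
  rewrite /S_det -det_map_mx; congr (\det _); apply/matrixP=> i j.
  by rewrite !mxE /= rmorphXn rmorphD rmorphM !rmorphXn.
split=> p_mod4; apply: modpP; rewrite S_detE det_norm_forms_Fp //.
  pose m := (p.-1 %/ 4)%N.
  have p_def : p = (m + m + m + m).+1 by rewrite /m; lia.
  have n_def : p.-1./2 = (m + m)%N by lia.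
  have -> : ((p + 3) %/ 4 = m.+1)%N by lia.
  have -> : ((p - 1) %/ 4 = m)%N by lia.
  have -> : ((p - 3) %/ 2 = (m + m).-1)%N by lia.
  rewrite n_def in d_unity *.
  rewrite big_split /= prod_expr_half // prod_centered_odds.
  rewrite half_expr_half_Fp // -mulrA [X in _ * X]mulrCA signrMK.
  rewrite !rmorphM !rmorphXn rmorphN /=.
  have -> : (- 1) ^+ (m + m).-1 = - 1 :> 'F_p.
    by rewrite -signr_odd; have -> : odd (m + m).-1 by lia.
  by rewrite (exprS _ m) (exprNn d%:~R) -pmulrn rmorph1; ring.
(* As [n = p.-1./2] is odd, the factor of index [n./2] contains [n - n]. *)
have k_lt : (p.-1./2./2 < p.-1./2)%N by lia.
rewrite (bigD1 (Ordinal k_lt)) //=.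
have -> : (p.-1./2./2 + p.-1./2./2).+1 = p.-1./2 by lia.
by rewrite subrr mulr0 mul0r mulr0.
Qed.
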